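(* Let $x\ge 1$ and $a,b,c\ge 0$ be integers and let $L = \{1^a, x^b, (2x)^c\}$. If $a \geq x-2$, $c$ is even and $b \geq 5x-2+c/2$, then the Buratti-Horak-Rosa Conjecture holds for $L$; that is, $L$ has a realization if and only if $L$ is admissible.
   Context: Multisets: exponents denote multiplicity, so $\{1^a,x^b,(2x)^c\}$ is the multiset consisting of $a$ copies of $1$, $b$ copies of $x$ and $c$ copies of $2x$ (it has size $a+b+c$). The underlying set of a multiset is the set of its distinct elements. Realizations: $K_v$ is the complete graph on the vertex set $\{0,1,\ldots,v-1\}$. The length of the edge between $x$ and $y$ in $K_v$ is $\ell(x,y)=\min(|x-y|,\,v-|x-y|)$. A realization of a multiset $L$ of size $v-1$ is a Hamiltonian path $[h_1,\ldots,h_v]$ in $K_v$ such that the multiset $\{\ell(h_i,h_{i+1}) : 1\le i\le v-1\}$ equals $L$. Admissibility: a multiset $L$ of size $v-1$ is admissible if its underlying set is contained in $\{1,\ldots,\lfloor v/2\rfloor\}$ and for every divisor $d$ of $v$ the number of multiples of $d$ appearing in $L$ (with multiplicity) is at most $v-d$. *)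

(* Defs.v *)
From mathcomp Require Import all_boot all_order all_algebra.
Set Implicit Arguments.
Unset Strict Implicit.
Unset Printing Implicit Defensive.

(* A finite multiset of natural numbers is represented by a list [L : seq nat]
   considered up to [perm_eq].  The complete graph attached to [L] has
   [num_vertices L] vertices, so that [L] has size v - 1 for v = num_vertices L. *)
Definition num_vertices (L : seq nat) : nat := (size L).+1.

Definition edge_length (v : nat) (x y : 'I_v) : nat :=
  minn `|x - y|%N (v - `|x - y|%N).

Definition edge_lengths (v : nat) (h : seq 'I_v) : seq nat :=
  if h is x :: p then pairmap (@edge_length v) x p else [::].

(* In a complete graph any two distinct vertices are adjacent, so a Hamiltonian
   path is just a list in which every vertex occurs exactly once. *)
Definition hamiltonian_path (v : nat) (h : seq 'I_v) : Prop :=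
  uniq h /\ forall x : 'I_v, x \in h.

Definition realization (L : seq nat) (h : seq 'I_(num_vertices L)) : Prop :=
  hamiltonian_path h /\ perm_eq (edge_lengths h) L.

(* The subtraction [num_vertices L - d] is never truncated, since [d %| num_vertices L] and
   [0 < num_vertices L] give [d <= num_vertices L]. *)
Definition admissible (L : seq nat) : Prop :=
  (forall l : nat, l \in L -> 1 <= l <= (num_vertices L)./2) /\
  (forall d : nat, d %| num_vertices L ->
     count (fun l => d %| l) L <= num_vertices L - d).

Definition BHR_holds (L : seq nat) : Prop :=
  (exists h : seq 'I_(num_vertices L), realization h) <-> admissible L.

(* Main.v *)
Require Import Defs.
From mathcomp Require Import all_boot all_order all_algebra.
From mathcomp Require Import zify.

Set Implicit Arguments.
Unset Strict Implicit.
Unset Printing Implicit Defensive.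

(** Necessity holds for every multiset: reducing a Hamiltonian path modulo a
divisor [d] of [v], all [d] residue classes are visited, so at least [d - 1]
edges change class, and the edges changing class are exactly those whose length
is not a multiple of [d] ([admissible_of_realization]).

For sufficiency, only the divisor condition for [d = x] is ever restrictive;
when it holds, a path is written down.  Put [e = a + 2 - x] and
[b + c + x - 1 = q * x + r] with [r < x], so that [v = q * x + r + e].  Arrange
the first [q * x + r] vertices in rows of length [x]: the columns are the
residue classes modulo [x], those of index below [r] have height [q + 1] and
the others height [q].
- Inside a column, edges of length [x] are vertical steps.  Four consecutive
  entries can also be visited as [0, 2, 1, 3], which uses two edges of length
  [2 * x] and one of length [x]; gluing such pieces end to end puts any even
  number of edges of length [2 * x] in the column, up to its capacity, while
  the column is still crossed from one end to the other ([climb]).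
- Adjacent columns of equal height have their tops and their bottoms at
  distance 1, so they can be crossed in boustrophedon order ([snake]).
- The two groups of columns have different heights, and a boustrophedon through
  both need not line up where they meet.  Instead, cross the columns
  [0, ..., r - 1] so as to finish at the bottom of column [r - 1], which is
  vertex [q * x + r - 1]; run through the remaining vertices up to [v - 1] by
  edges of length 1; take the edge from [v - 1] to [x - 1], which has cyclic
  length [x] and lands on the top of column [x - 1]; then cross the columns
  [x - 1, ..., r].
This uses [x + e - 2 = a] edges of length 1, and is meaningful as soon as
[r + e > 0].  If [r = e = 0] then [x] divides [v] and only [a = x - 2 < x - 1]
lengths are not multiples of [x], so the multiset is not admissible.  The lower
bound on [b] makes the columns high enough to absorb the [c / 2] pieces. *)

(** * Cyclic lengths of a sequence of natural numbers *)

(** The path is built from plain natural numbers rather than elements of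
[ordinal v], so that blocks can be described by arithmetic and their bounds
checked only once, at the end. *)
Definition cdist (v s t : nat) : nat :=
  minn ((s - t) + (t - s)) (v - ((s - t) + (t - s))).

Definition steps (v : nat) (s : seq nat) : seq nat :=
  if s is t :: p then pairmap (cdist v) t p else [::].

Lemma edge_lengthE v (s t : 'I_v) : edge_length s t = cdist v s t.
Proof. rewrite /edge_length /cdist; lia. Qed.

Lemma edge_lengthsE v (h : seq 'I_v) :
  edge_lengths h = steps v (map (@nat_of_ord v) h).
Proof.
case: h => //= s p; elim: p s => //= t p IHp s.
by rewrite IHp edge_lengthE.
Qed.

Lemma cdistC v s t : cdist v s t = cdist v t s.
Proof. rewrite /cdist; lia. Qed.

Lemma cdist_add v s d : d.*2 <= v -> cdist v s (s + d) = d.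
Proof. rewrite /cdist; lia. Qed.

Lemma steps_cat v s1 s2 : s1 != [::] -> s2 != [::] ->
  steps v (s1 ++ s2) =
  steps v s1 ++ cdist v (last 0 s1) (head 0 s2) :: steps v s2.
Proof.
by case: s1 => // s p; case: s2 => // t p' _ _ /=; rewrite pairmap_cat.
Qed.

(** Multisets of lengths are compared through the counts of an arbitrary
predicate, which turns rearrangements into linear arithmetic. *)
Lemma count_steps_cat v P s1 s2 : s1 != [::] -> s2 != [::] ->
  count P (steps v (s1 ++ s2)) =
  count P (steps v s1) + P (cdist v (last 0 s1) (head 0 s2))
  + count P (steps v s2).
Proof. by move=> n1 n2; rewrite steps_cat // count_cat /= addnA. Qed.

Lemma last_rev_head (s : seq nat) : last 0 (rev s) = head 0 s.
Proof. by case: s => // t s; rewrite rev_cons last_rcons. Qed.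

Lemma head_rev_last (s : seq nat) : head 0 (rev s) = last 0 s.
Proof. by rewrite -{2}[s]revK last_rev_head. Qed.

Lemma rev_eq_nil (s : seq nat) : (rev s == [::]) = (s == [::]).
Proof. by rewrite -!size_eq0 size_rev. Qed.

Lemma count_steps_rev v P s : count P (steps v (rev s)) = count P (steps v s).
Proof.
elim: s => // t s IHs; case: (eqVneq s [::]) => [-> // | s_n0].
rewrite rev_cons -cats1 count_steps_cat ?rev_eq_nil // IHs.
rewrite -[in RHS]cat1s count_steps_cat //= last_rev_head cdistC; lia.
Qed.

Lemma count_steps_iota v P n s : 2 <= v -> 0 < n ->
  count P (steps v (iota s n)) = n.-1 * P 1.
Proof.
move=> v_ge2; case: n => // n _ /=; elim: n s => //= n IHn s.
by rewrite -[s.+1]addn1 cdist_add // IHn mulSn.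
Qed.

(** * Crossing the columns *)

Section Climb.

Variable x : nat.

(** Goes up from [t] by [k] pieces [t, t + 2x, t + x, (t + 3x)] followed by a
straight run of [n] vertices.  Each piece stops before [t + 3x], where the next
one starts; hence [n > 0] is what makes the sequence end at its maximum. *)
Fixpoint climb (k n t : nat) : seq nat :=
  if k is k'.+1 then [:: t, t + 2 * x, t + x & climb k' n (t + 3 * x)]
  else traject (addn x) t n.

Lemma size_climb k n t : size (climb k n t) = 3 * k + n.
Proof. by elim: k t => [|k IHk] t /=; rewrite ?size_traject // IHk; lia. Qed.

Lemma head_climb k n t : 0 < n -> head 0 (climb k n t) = t.
Proof. by case: k => // [] /=; case: n. Qed.

Lemma last_climb k n t : 0 < n ->
  last 0 (climb k n t) = t + (3 * k + n).-1 * x.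
Proof.
case: n => // n _; elim: k t => [|k IHk] t.
  by rewrite /= last_traject iter_addn addnC mulnC.
have -> : (3 * k.+1 + n.+1).-1 = 3 + (3 * k + n.+1).-1 by lia.
rewrite mulnDl addnA -IHk /=.
by case: (climb _ _ _) (size_climb k n.+1 (t + 3 * x)) => //=; lia.
Qed.

Lemma mem_climb k n t i : i < 3 * k + n -> t + i * x \in climb k n t.
Proof.
elim: k t i => [|k IHk] t i /= lt_i.
  elim: n t i lt_i => // n IHn t [|i] lt_i /=.
    by rewrite addn0 mem_head.
  by rewrite inE mulSn addnA [t + x]addnC IHn ?orbT //; lia.
case: i lt_i => [|[|[|i]]] lt_i; rewrite !inE ?addn0 ?mul1n ?eqxx ?orbT //.
have -> : t + i.+3 * x = t + 3 * x + i * x by lia.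
by rewrite IHk ?orbT //; lia.
Qed.

Section Snake.

Variables (m : nat) (f : nat -> nat).

Definition column (j : nat) : seq nat := climb (f j) (m - 3 * f j) j.

(** Columns are crossed from index [lo + n - 1] to [lo], alternately by
increasing ([down = true]) and decreasing rows.  Decreasing indices suit the
construction: one group of columns is entered at its last index, and the other
must be left there, so its snake is reversed. *)
Fixpoint snake (down : bool) (lo n : nat) : seq nat :=
  if n is n'.+1 then
    (if down then column (lo + n') else rev (column (lo + n')))
      ++ snake (~~ down) lo n'
  else [::].

Hypothesis f_small : forall j, 3 * f j < m.

Lemma size_snake d lo n : size (snake d lo n) = n * m.
Proof.
elim: n d => //= n IHn d; rewrite size_cat IHn.
have := f_small (lo + n).
by case: d; rewrite ?size_rev size_climb; lia.
Qed.

Lemma snake_nil d lo n : (snake d lo n == [::]) = (n == 0).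
Proof. rewrite -size_eq0 size_snake; have := f_small 0; nia. Qed.

Lemma column_nil j : (column j == [::]) = false.
Proof. rewrite -size_eq0 size_climb; have := f_small j; lia. Qed.

Lemma head_column j : head 0 (column j) = j.
Proof. by rewrite head_climb //; have := f_small j; lia. Qed.

Lemma last_column j : last 0 (column j) = j + m.-1 * x.
Proof.
have f_j := f_small j; rewrite last_climb; last lia.
by have -> : 3 * f j + (m - 3 * f j) = m by lia.
Qed.

Lemma head_snake d lo n : 0 < n ->
  head 0 (snake d lo n) = lo + n.-1 + (if d then 0 else m.-1 * x).
Proof.
case: n => //= n _.
have head_cat (s1 s2 : seq nat) : s1 != [::] -> head 0 (s1 ++ s2) = head 0 s1.
  by case: s1.
by case: d; rewrite head_cat ?rev_eq_nil ?column_nil //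
  ?head_rev_last ?head_column ?last_column ?addn0.
Qed.

(** Together with [size_snake], this is all that is needed on vertex sets: a
sequence of size [v] containing all of [0, ..., v - 1] has no repetition, so
disjointness of the blocks is never proved directly. *)
Lemma mem_snake d lo n i j : lo <= j < lo + n -> i < m ->
  j + i * x \in snake d lo n.
Proof.
move=> j_in lt_i; elim: n d j_in => [|n IHn] d j_in /=; first lia.
rewrite mem_cat; case: (eqVneq j (lo + n)) => [<- | j_ne].
  have : j + i * x \in column j by apply: mem_climb; lia.
  by case: d; rewrite ?mem_rev => ->.
by rewrite IHn ?orbT //; lia.
Qed.

End Snake.
End Climb.

(** * Lengths used by a block of columns *)

Section StepCounts.

Variables (v x : nat).
Hypotheses (x_gt0 : 0 < x) (x_small : 4 * x <= v).

Lemma count_steps_climb P k n t : 0 < n ->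
  count P (steps v (climb x k n t)) =
  (k + n.-1) * P x + (2 * k) * P (2 * x).
Proof.
move=> n_gt0; elim: k t => [|k IHk] t.
  case: n n_gt0 => // n _ /=; elim: n t => //= n IHn t.
  by rewrite IHn addnC [x + t]addnC cdist_add; lia.
rewrite -[climb x k.+1 n t]
  /([:: t; t + 2 * x; t + x] ++ climb x k n (t + 3 * x)).
rewrite count_steps_cat; [|by []|by rewrite -size_eq0 size_climb; lia].
rewrite IHk head_climb //= cdist_add; last lia.
have -> : t + 2 * x = t + x + x by lia.
rewrite cdistC cdist_add; last lia.
have -> : t + 3 * x = t + x + 2 * x by lia.
rewrite cdist_add; lia.
Qed.

Variables (m : nat) (f : nat -> nat).
Hypothesis f_small : forall j, 3 * f j < m.

(** Each edge of length [2 * x] replaces one of length [x]; the term in [P x] on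
the left expresses this without subtraction. *)
Lemma count_steps_snake P d lo n : 0 < n ->
  count P (steps v (snake x m f d lo n))
    + 2 * (\sum_(lo <= j < lo + n) f j) * P x =
  n.-1 * P 1 + n * m.-1 * P x + 2 * (\sum_(lo <= j < lo + n) f j) * P (2 * x).
Proof.
have count_column j : count P (steps v (column x m f j)) + 2 * f j * P x =
    m.-1 * P x + 2 * f j * P (2 * x).
  have f_j := f_small j; rewrite count_steps_climb; last lia.
  have -> : m.-1 = f j + (m - 3 * f j).-1 + 2 * f j by lia.
  by rewrite [in RHS]mulnDl addnAC.
move=> n_gt0.
case: n n_gt0 => // n _; elim: n d => [|n IHn] d.
  rewrite addn1 big_nat1 /= cats0 addn0 mul1n.
  by case: d; rewrite ?count_steps_rev count_column.
rewrite addnS big_nat_recr; last lia.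
set s := if d then column x m f (lo + n.+1) else rev (column x m f (lo + n.+1)).
have s_n0 : s != [::] by rewrite /s; case: (d); rewrite ?rev_eq_nil column_nil.
have last_s : last 0 s = lo + n.+1 + (if d then m.-1 * x else 0).
  by rewrite /s; case: (d); rewrite ?last_rev_head ?head_column ?last_column
    ?addn0.
have count_s :
    count P (steps v s) = count P (steps v (column x m f (lo + n.+1))).
  by rewrite /s; case: (d); rewrite ?count_steps_rev.
rewrite -[snake x m f d lo n.+2]/(s ++ snake x m f (~~ d) lo n.+1).
rewrite count_steps_cat ?snake_nil // count_s last_s head_snake //.
(* Consecutive columns are joined in the same row, at offset [y]. *)
rewrite succnK; set y := if d then _ else _.
have -> : (if ~~ d then 0 else m.-1 * x) = y by rewrite /y; case: (d).
have -> : lo + n.+1 + y = lo + n + y + 1 by lia.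
rewrite cdistC cdist_add; last lia.
have := count_column (lo + n.+1); have := IHn (~~ d); rewrite addnS !succnK.
move: (count _ _) (count _ _) (\sum_(_ <= j < _) _) (f _) m.-1.
move: (nat_of_bool (P x)) (nat_of_bool (P 1)) (nat_of_bool (P (2 * x))).
by move=> /=; lia.
Qed.

End StepCounts.

(** * The Hamiltonian path *)

(** Greedy distribution of [k] pieces among columns of capacity [p] each. *)
Definition quota (p k j : nat) : nat := minn p (k - j * p).

Lemma sum_quota p k n : \sum_(0 <= j < n) quota p k j = minn k (n * p).
Proof.
elim: n => [|n IHn]; first by rewrite big_nil mul0n minn0.
rewrite big_nat_recr //= IHn /quota mulSn; lia.
Qed.

Section Construction.

Variables (v x q r e k : nat).
Hypotheses (x_gt0 : 0 < x) (x_small : 4 * x <= v) (q_gt0 : 0 < q).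
Hypotheses (r_lt : r < x) (re_gt0 : 0 < r + e) (vE : v = q * x + r + e).
Hypothesis (k_small : k <= x * (q.-1 %/ 3)).

(* The capacity of the shorter columns is used for all of them. *)
Let f := quota (q.-1 %/ 3) k.

Let f_small j : 3 * f j < q.
Proof.
have := leq_divM q.-1 3; have : f j <= q.-1 %/ 3 by apply: geq_minl.
lia.
Qed.

Let f_smallS j : 3 * f j < q.+1.
Proof. exact: ltnW (f_small j). Qed.

Definition left_part : seq nat :=
  rev (snake x q.+1 f false 0 r) ++ iota (q * x + r) e.

Definition right_part : seq nat := snake x q f true r (x - r).

Lemma left_part_nil : left_part != [::].
Proof.
rewrite -size_eq0 size_cat size_rev size_snake // size_iota; lia.
Qed.

(** If [e = 0] the last vertex is the bottom of column [r - 1], which is then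
[v - 1]; otherwise it is the end of the run of edges of length 1. *)
Lemma last_left_part : last 0 left_part = v.-1.
Proof.
rewrite last_cat; case: (posnP e) => [e0 | e_gt0].
  rewrite e0 /= last_rev_head head_snake //=; last lia.
  lia.
rewrite -nth_last size_iota (set_nth_default 0) ?size_iota ?nth_iota; lia.
Qed.

(** Joining [r] columns and [e] single vertices in a row takes [r + e - 1] edges
of length 1, including when [r] or [e] is zero. *)
Lemma count_steps_left_part P :
  count P (steps v left_part) + 2 * (\sum_(0 <= j < r) f j) * P x =
  (r + e).-1 * P 1 + r * q * P x + 2 * (\sum_(0 <= j < r) f j) * P (2 * x).
Proof.
have v_ge2 : 2 <= v by lia.
rewrite /left_part; case: (posnP r) => [r0 | r_gt0].
  by rewrite r0 /= count_steps_iota ?big_geq //; lia.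
have := count_steps_snake x_gt0 x_small f_smallS P false 0 r_gt0.
rewrite add0n succnK -(count_steps_rev v P (snake _ _ _ _ _ _)).
case: (posnP e) => [-> | e_gt0]; first by rewrite cats0 addn0.
rewrite count_steps_cat ?rev_eq_nil ?snake_nil //; try lia; last first.
  by rewrite -size_eq0 size_iota; lia.
rewrite count_steps_iota //.
rewrite last_rev_head head_snake // succnK.
have -> : head 0 (iota (q * x + r) e) = 0 + r.-1 + q * x + 1.
  by case: (e) e_gt0 => //= *; lia.
rewrite cdist_add //.
have -> : (r + e).-1 = r.-1 + 1 + e.-1 by lia.
rewrite !mulnDl mul1n; lia.
Qed.

Definition tour : seq nat := left_part ++ right_part.

Lemma size_tour : size tour = v.
Proof.
rewrite !size_cat size_rev !size_snake // size_iota vE.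
have : (x - r) * q + r * q = q * x by rewrite -mulnDl (subnK (ltnW r_lt)) mulnC.
lia.
Qed.

Lemma mem_tour t : t < v -> t \in tour.
Proof.
move=> lt_t; rewrite !mem_cat mem_rev mem_iota.
case: (ltnP t (q * x + r)) => [lt_t' | ge_t]; last by rewrite -vE lt_t orbT.
move: (t %/ x) (t %% x) (ltn_pmod t x_gt0) (divn_eq t x) => i j lt_j tE.
move: lt_t'; rewrite tE [_ + j]addnC => lt_t'.
case: (ltnP j r) => [lt_r | ge_r].
  rewrite mem_snake //=; nia.
rewrite [X in _ || X](mem_snake _ _ true) ?orbT //; nia.
Qed.

Lemma count_steps_tour P :
  count P (steps v tour) + 2 * k * P x =
  (x + e - 2) * P 1 + (x * q.-1 + r).+1 * P x + 2 * k * P (2 * x).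
Proof.
have xr_gt0 : 0 < x - r by lia.
have kE : k = \sum_(0 <= j < r) f j + \sum_(r <= j < x) f j.
  by rewrite -big_cat_nat //= ?sum_quota; lia.
rewrite count_steps_cat ?left_part_nil ?snake_nil //; try lia.
rewrite last_left_part head_snake // addn0.
(* The edge wrapping around from [v - 1] to the top of column [x - 1]. *)
have -> : cdist v v.-1 (r + (x - r).-1) = x.
  by rewrite /cdist; lia.
have := count_steps_left_part P.
have := count_steps_snake x_gt0 x_small f_small P true r xr_gt0.
rewrite subnKC ?(ltnW r_lt) // -/right_part kE.
have -> : x + e - 2 = (r + e).-1 + (x - r).-1 by lia.
have -> : (x * q.-1 + r).+1 = r * q + (x - r) * q.-1 + 1.
  have : r * q = r * q.-1 + r by rewrite -{1}(prednK q_gt0) mulnS addnC.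
  have : (x - r) * q.-1 + r * q.-1 = x * q.-1 by rewrite -mulnDl (subnK (ltnW r_lt)).
  lia.
move: (\sum_(_ <= j < _) _) (\sum_(_ <= j < _) _) (count _ _) (count _ _).
move: (nat_of_bool (P x)) (nat_of_bool (P 1)) (nat_of_bool (P (2 * x))).
move: (r + e).-1 (x - r).-1 (r * q) ((x - r) * q.-1).
lia.
Qed.

End Construction.

(** * Realizations and admissibility *)

Lemma realization_of_nat_path L s :
  size s = num_vertices L -> (forall t, t < num_vertices L -> t \in s) ->
  perm_eq (steps (num_vertices L) s) L ->
  exists h : seq 'I_(num_vertices L), realization h.
Proof.
rewrite /realization; move: (num_vertices L) => v s_size s_full s_steps.
have sub : {subset iota 0 v <= s}.
  by move=> t; rewrite mem_iota => /andP[_] /s_full.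
have le_s : size s <= size (iota 0 v) by rewrite size_iota s_size.
have s_uniq : uniq s := leq_size_uniq (iota_uniq 0 v) sub le_s.
have [_ s_mem] := uniq_min_size (iota_uniq 0 v) sub le_s.
have hE : map (@nat_of_ord v) (pmap insub s) = s.
  rewrite pmap_filter; last exact: insubK.
  apply/all_filterP/allP => t; rewrite -s_mem mem_iota => /andP[_ lt_t].
  by rewrite insubT.
have h_uniq : uniq (pmap insub s : seq 'I_v).
  by rewrite -(map_inj_uniq val_inj) hE.
exists (pmap insub s); split; last by rewrite edge_lengthsE hE.
by split=> // t; rewrite -(mem_map val_inj) hE -s_mem mem_iota /=.
Qed.

(** Along a sequence, a new value of [g] can only appear at a change. *)
Lemma size_undup_map_leq_changes (T : eqType) (R : eqType) (g : T -> R) t p :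
  size (undup (map g (t :: p))) <=
  (count id (pairmap (fun u w => g u != g w) t p)).+1.
Proof.
elim: p t => [//|u p IHp] t.
have := IHp u; move E: (map g (u :: p)) => gs le_gs.
have g_u : g u \in gs by rewrite -E mem_head.
rewrite [map _ _]/= -[g u :: _]/(map g (u :: p)) E /=.
case: (eqVneq (g t) (g u)) => [-> | _]; first by rewrite g_u.
by case: ifP => //= _; lia.
Qed.

(** Taking the complement to [v] does not affect divisibility by a divisor of
[v]. *)
Lemma dvdn_cdist d v s t : d %| v -> s < v -> t < v ->
  (d %| cdist v s t) = (s %% d == t %% d).
Proof.
move=> d_v lt_s lt_t; wlog le_st : s t lt_s lt_t / s <= t => [IH|].
  by case: (leqP s t) => [/IH-> // | /ltnW/IH]; rewrite cdistC eq_sym => ->.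
have -> : cdist v s t = minn (t - s) (v - (t - s)) by rewrite /cdist; lia.
rewrite eq_sym eqn_mod_dvd // /minn; case: ifP => // _.
by rewrite dvdn_subr //; lia.
Qed.

Lemma admissible_of_realization L (h : seq 'I_(num_vertices L)) :
  realization h -> admissible L.
Proof.
rewrite /realization /admissible; have : 0 < num_vertices L by [].
move: (num_vertices L) h => v h v_gt0 [[h_uniq h_full]].
rewrite edge_lengthsE => hL; split.
  move=> l; rewrite -(perm_mem hL).
  case: h {hL h_full} h_uniq => //= s p; elim: p s => //= t p IHp s.
  rewrite !inE negb_or -!andbA => /and4P[ne_st s_p t_p p_uniq].
  case/orP => [/eqP-> | l_in]; last first.
    by apply: (IHp t) => //=; rewrite t_p.
  have : (s : nat) != t := ne_st.
  by have := ltn_ord s; have := ltn_ord t; rewrite /cdist; lia.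
move=> d d_v; rewrite -(permP hL).
have d_gt0 := dvdn_gt0 v_gt0 d_v.
have d_le := dvdn_leq v_gt0 d_v.
pose g (u : 'I_v) := u %% d.
have size_hv : size h = v.
  rewrite -(card_uniqP h_uniq) -[RHS]card_ord; apply: eq_card => u.
  by rewrite h_full.
case: h {hL h_uniq} h_full size_hv => [|s p] h_full size_hv.
  by rewrite /= in size_hv; lia.
have d_classes : d <= size (undup (map g (s :: p))).
  rewrite -[X in X <= _](size_iota 0); apply: uniq_leq_size (iota_uniq _ _) _.
  move=> i; rewrite mem_iota => /andP[_ lt_i]; rewrite mem_undup.
  have lt_iv : i < v by apply: leq_trans d_le.
  by apply/mapP; exists (Ordinal lt_iv); rewrite // /g /= modn_small.
have := leq_trans d_classes (size_undup_map_leq_changes g s p).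
have -> : count id (pairmap (fun u w => g u != g w) s p) =
    count (predC (fun l => d %| l)) (steps v (map (@nat_of_ord v) (s :: p))).
  elim: (p) s {h_full size_hv d_classes} => //= t p' IHp s.
  by rewrite IHp dvdn_cdist.
have := count_predC (fun l => d %| l) (steps v (map (@nat_of_ord v) (s :: p))).
rewrite /= size_pairmap size_map; rewrite /= in size_hv; lia.
Qed.

Theorem theorem5p10 (x a b c : nat) (hx : 1 <= x) (ha : x <= a + 2)
    (hc : ~~ odd c) (hb : 5 * x - 2 + c./2 <= b) :
  BHR_holds (nseq a 1 ++ nseq b x ++ nseq c (2 * x)).
Proof.
split=> [[h] | [_ adm]]; first exact: admissible_of_realization.
move: adm; set L := (L in num_vertices L) => adm.
have vE : num_vertices L = (a + b + c).+1.
  by rewrite /num_vertices !size_cat !size_nseq addnA.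
have cE : c = 2 * c./2 by rewrite mul2n even_halfK.
set k := c./2 in hb cE.
pose w := b + c + x - 1; pose q := w %/ x; pose r := w %% x.
pose e := a + 2 - x.
have wE : w = q * x + r by apply: divn_eq.
have r_lt : r < x by rewrite ltn_pmod.
have vE' : num_vertices L = q * x + r + e by rewrite -wE vE /w /e; lia.
have q_gt0 : 0 < q by rewrite divn_gt0 // /w; lia.
have x_small : 4 * x <= num_vertices L by rewrite vE; lia.
(* The only use of admissibility, at the divisor [x]. *)
have re_gt0 : 0 < r + e.
  rewrite lt0n; apply/eqP => re0.
  have x_v : x %| num_vertices L.
    by rewrite vE' -addnA re0 addn0 dvdn_mull.
  have := adm x x_v; rewrite !count_cat !count_nseq dvdnn dvdn_mull // vE.
  have : x = a + 2 by rewrite /e in re0; lia.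
  by move: (_ * a) => n; clear -hb; lia.
have wE' : x * q.-1 + r + x = w.
  by rewrite wE -{2}(prednK q_gt0) mulSn addnAC [x * _]mulnC [x + _]addnC.
(* Rounding down [(q - 1) / 3] loses at most 2 rows in each column, that is
   [2 * x] vertices in all, which [b >= 5 * x - 2 + k] compensates. *)
have k_small : k <= x * (q.-1 %/ 3).
  have := ltn_ceil q.-1 (isT : 0 < 3); rewrite mulSn.
  move: (q.-1 %/ 3) => p lt_p.
  have : 3 * k <= x * (3 * p); last lia.
  have : x * q.-1 <= x * (3 * p) + x * 2 by rewrite -mulnDr leq_mul2l; lia.
  by rewrite /w in wE'; lia.
pose s := tour x q r e k.
apply: (@realization_of_nat_path L s).
- exact: size_tour.
- exact: mem_tour.
apply/permP => P; rewrite !count_cat !count_nseq.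
have := count_steps_tour hx x_small q_gt0 r_lt re_gt0 vE' k_small P.
have -> : x + e - 2 = a by rewrite /e; lia.
have -> : (x * q.-1 + r).+1 = b + 2 * k by rewrite /w in wE'; lia.
rewrite -cE -/s mulnDl ![P _ * _]mulnC.
move: (count _ _) (a * _) (b * _) (c * P x) (c * _); clear; lia.
Qed.
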